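(* Let $\Gamma$ be a compact metric graph, $d\ge0$, and let $T,T'\subseteq\mathrm{Div}^d_{+,\mathbb R}(\Gamma)$ be tropically convex. Then $$\mathrm{tconv}(T\cup T')=\bigcup_{D\in T,\,D'\in T'}\mathrm{tconv}(D,D').$$ If in addition $T$ and $T'$ are compact, then $\mathrm{tconv}(T\cup T')$ is compact.
   Context: $\Gamma$ is a compact metric graph (finitely many edges of finite length). An $\mathbb R$-divisor is a finite formal sum $\sum_p m_p(p)$, $m_p\in\mathbb R$, $p\in\Gamma$; effective means all $m_p\ge0$; degree is $\sum m_p$. $\mathrm{Div}^d_{+,\mathbb R}(\Gamma)$ is the set of effective $\mathbb R$-divisors of degree $d$. For a continuous piecewise-linear $f$ on $\Gamma$, $\Delta f=\sum_p\sigma_p(f)(p)$ where $-\sigma_p(f)$ is the sum of the outgoing slopes of $f$ at $p$. For effective $D_1,D_2$ of equal degree, $f_{D_2-D_1}$ denotes a continuous piecewise-linear function with $\Delta f_{D_2-D_1}=D_2-D_1$ (unique up to additive constant). The metric is $\rho(D_1,D_2)=\max f_{D_2-D_1}-\min f_{D_2-D_1}$; compactness refers to this metric. The tropical segment $\mathrm{tconv}(D_1,D_2)$ is the image of $t\mapsto D_1+\Delta\min(t\rho(D_1,D_2),f_{D_2-D_1}-\min f_{D_2-D_1})$, $t\in[0,1]$. A set is tropically convex if it contains $\mathrm{tconv}(D_1,D_2)$ for any two of its elements $D_1,D_2$. For $S\subseteq\mathrm{Div}^d_{+,\mathbb R}(\Gamma)$, $\mathrm{tconv}(S)$ is the intersection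 of all tropically convex subsets of $\mathrm{Div}^d_{+,\mathbb R}(\Gamma)$ containing $S$.
   Formalization: The union formula is stated when T and T' are both nonempty or both empty (it fails if exactly one is empty: the right side is then empty); Γ is taken connected and nonempty, as existence and uniqueness of f_{D2-D1} up to a constant requires. *)

(* Defs.v *)
From HB Require Import structures.
From mathcomp Require Import all_boot all_order all_algebra.
From mathcomp Require Import all_classical all_reals all_analysis.

Set Implicit Arguments.
Unset Strict Implicit.
Unset Printing Implicit Defensive.

Import Order.TTheory GRing.Theory Num.Theory.
Import numFieldNormedType.Exports.

Local Open Scope classical_set_scope.
Local Open Scope ring_scope.

(* A compact connected metric graph, given by a finite model: loops and
   parallel edges are allowed, and the edge [e] is glued from the segment
   [0, len e], with 0 attached to [src e] and [len e] attached to [tgt e].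
   Connectedness is what makes f_{D2-D1} exist and be unique up to a constant. *)
Record metric_graph (R : realType) := MetricGraph {
  vertex : finType;
  edge : finType;
  src : edge -> vertex;
  tgt : edge -> vertex;
  len : edge -> R;
  len_gt0 : forall e, 0 < len e;
  vertex_gt0 : (0 < #|vertex|)%N;
  graph_connected : forall u v,
    connect (fun x y => [exists e, ((src e == x) && (tgt e == y)) ||
                                   ((src e == y) && (tgt e == x))]) u v
}.

Section Gamma.
Context {R : realType} (G : metric_graph R).

Variant gpoint : Type :=
| Vtx of vertex G
| Mid (e : edge G) of {x : R | 0 < x < len e}.

HB.instance Definition _ := gen_eqMixin gpoint.
HB.instance Definition _ := gen_choiceMixin gpoint.

(* The gluing map [0, len e] -> Gamma; constant outside that segment. *)
Definition edge_point (e : edge G) (x : R) : gpoint :=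
  if insub x is Some u then @Mid e u
  else Vtx (if x <= 0 then src e else tgt e).

(* [s] lists possible break points.  Since the pieces are closed intervals, g is
   automatically continuous on [a, b]. *)
Definition piecewise_linear (a b : R) (g : R -> R) : Prop :=
  exists s : seq R, forall x y, a <= x -> x <= y -> y <= b ->
    (forall c, c \in s -> ~ (x < c < y)) ->
    exists m k, forall z, x <= z <= y -> g z = m * z + k.

Definition cont_pl (f : gpoint -> R) : Prop :=
  forall e, piecewise_linear 0 (len e) (f \o edge_point e).

(* Slopes of g at x away from x, towards larger and smaller arguments. *)
Definition slope_up (g : R -> R) (x : R) : R :=
  lim ((g (x + h) - g x) / h @[h --> 0^'+]).

Definition slope_down (g : R -> R) (x : R) : R :=
  lim ((g (x - h) - g x) / h @[h --> 0^'+]).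

(* A loop at v contributes two outgoing directions at v. *)
Definition outgoing_slopes (f : gpoint -> R) (p : gpoint) : R :=
  match p with
  | Vtx v => \sum_(e | src e == v) slope_up (f \o edge_point e) 0
           + \sum_(e | tgt e == v) slope_down (f \o edge_point e) (len e)
  | Mid e u => slope_up (f \o edge_point e) (val u)
             + slope_down (f \o edge_point e) (val u)
  end.

Definition laplacian (f : gpoint -> R) : gpoint -> R :=
  fun p => - outgoing_slopes f p.

(* An R-divisor is represented by its coefficient function p |-> m_p. *)
Definition effdiv (d : R) : set (gpoint -> R) :=
  [set D | [/\ finite_set [set p | D p != 0],
               forall p, 0 <= D p
             & \sum_(p \in [set: gpoint]) D p = d]].

Definition potential (D1 D2 : gpoint -> R) : gpoint -> R :=
  xget (fun=> 0) [set f | cont_pl f /\ laplacian f = D2 \- D1].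

(* f_{D2-D1} is continuous on a nonempty compact space, so that its sup and inf
   are its max and min. *)
Definition rho (D1 D2 : gpoint -> R) : R :=
  sup (range (potential D1 D2)) - inf (range (potential D1 D2)).

Definition tsegment_path (D1 D2 : gpoint -> R) (t : R) : gpoint -> R :=
  D1 \+ laplacian (fun p => Num.min (t * rho D1 D2)
    (potential D1 D2 p - inf (range (potential D1 D2)))).

Definition tsegment (D1 D2 : gpoint -> R) : set (gpoint -> R) :=
  tsegment_path D1 D2 @` [set t | 0 <= t <= 1].

Definition tconvex (T : set (gpoint -> R)) : Prop :=
  forall D1 D2, T D1 -> T D2 -> tsegment D1 D2 `<=` T.

Definition tconv (d : R) (S : set (gpoint -> R)) : set (gpoint -> R) :=
  \bigcap_(C in [set C | [/\ C `<=` effdiv d, tconvex C & S `<=` C]]) C.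

(* effdiv d as a type, to carry the topology of the metric rho. *)
Record effdiv_type (d : R) := EffDiv {
  effdiv_val : gpoint -> R;
  effdiv_valP : effdiv d effdiv_val
}.

HB.instance Definition _ d := gen_eqMixin (effdiv_type d).
HB.instance Definition _ d := gen_choiceMixin (effdiv_type d).

Definition rho_open (d : R) (U : set (effdiv_type d)) : Prop :=
  forall D, U D -> exists2 r : R, 0 < r &
    forall D', rho (effdiv_val D) (effdiv_val D') < r -> U D'.

Lemma rho_openT d : @rho_open d setT.
Proof. by move=> D _; exists 1. Qed.

Lemma rho_openI d (U V : set (effdiv_type d)) :
  rho_open U -> rho_open V -> rho_open (U `&` V).
Proof.
move=> oU oV D [/oU[r r0 rU] /oV[s s0 sV]].
exists (Num.min r s); first by rewrite lt_min r0.
by move=> D'; rewrite lt_min => /andP[/rU ? /sV].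
Qed.

Lemma rho_open_bigU d (I : Type) (f : I -> set (effdiv_type d)) :
  (forall i, rho_open (f i)) -> rho_open (\bigcup_i f i).
Proof.
move=> of_ D [i _ /of_[r r0 rf]]; exists r => // D' /rf fD'.
by exists i.
Qed.

HB.instance Definition _ d := isOpenTopological.Build (effdiv_type d)
  (@rho_openT d) (@rho_openI d) (@rho_open_bigU d).

Definition rho_compact (d : R) (T : set (gpoint -> R)) : Prop :=
  compact ((@effdiv_val d) @^-1` T).

End Gamma.

(* Main.v *)
From HB Require Import structures.
Require Import Defs.
From mathcomp Require Import all_boot all_order all_algebra.
From mathcomp Require Import all_classical all_reals all_analysis.
From mathcomp Require Import ring lra.

Set Implicit Arguments.
Unset Strict Implicit.
Unset Printing Implicit Defensive.

Import Order.TTheory GRing.Theory Num.Theory.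
Import numFieldNormedType.Exports.

Local Open Scope classical_set_scope.
Local Open Scope ring_scope.

(* Fix a base divisor D0 and represent D by a piecewise linear f with
   D = D0 + Delta f, unique up to a constant.  Then tconv(D1, D2) consists of the
   divisors of min(f1, f2), with f1 and f2 ranging over all representatives of D1
   and D2, so the union of the segments between T and T' is represented by the
   functions min(f, f') with D0 + Delta f in T and D0 + Delta f' in T'.  Closure
   under min is min(min(f, f'), min(g, g')) = min(min(f, g), min(f', g')).
   As (D, D', t) |-> D + Delta min(t rho, f_{D'-D} - min f_{D'-D}) is continuous
   for rho, this union is the image of the compact T x T' x [0, 1].
   Potentials exist because tents move every divisor to the vertices, where the
   discrete Laplacian, having only constants in its kernel (maximum principle),
   reaches all functions of sum 0. *)

(** * Piecewise linear functions on an interval *)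

Section PiecewiseLinear.
Context {R : realType}.
Implicit Types (g h : R -> R) (a b x y z m k s : R).

Definition affine_on x y g := exists m k, forall z, x <= z <= y -> g z = m * z + k.

(** Induction over the pieces: the listed break points are removed one by one, and the interval is
    cut at [c] whenever [c] lies strictly inside it. Later proofs then handle only an affine piece
    and a joint of two adjacent intervals. *)
Lemma pl_ind g a b (P : R -> R -> Prop) : a < b -> piecewise_linear a b g ->
  (forall x y, a <= x -> x < y -> y <= b -> affine_on x y g -> P x y) ->
  (forall x y z, a <= x -> x < y -> y < z -> z <= b ->
    P x y -> P y z -> P x z) ->
  P a b.
Proof.
move=> ab [s gs] Paff Pglue.
suff H : forall (s' : seq R) x y, a <= x -> x < y -> y <= b ->
    (forall u v, x <= u -> u <= v -> v <= y ->
      (forall c, c \in s' -> ~ (u < c < v)) -> affine_on u v g) -> P x y.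
  by apply: (H s) => // u v au uv vb; exact: gs.
elim=> [|c s' IH] x y ax xy yb gxy.
  by apply: Paff => //; apply: gxy => //; exact: ltW.
have [/andP[xc cy]|cxy] := boolP (x < c < y).
  apply: (Pglue x c y) => //; apply: IH => //.
  - exact: le_trans (ltW cy) yb.
  - move=> u v xu uv vc us; apply: gxy => //; first exact: le_trans (ltW cy).
    move=> c'; rewrite in_cons => /predU1P[->|/us//].
    by case/andP => _ /(le_lt_trans vc); rewrite ltxx.
  - exact: le_trans (ltW xc).
  - move=> u v cu uv vy us; apply: gxy => //; first exact: le_trans (ltW xc) _.
    move=> c'; rewrite in_cons => /predU1P[->|/us//].
    by case/andP => /(le_lt_trans cu); rewrite ltxx.
apply: IH => // u v xu uv vy us; apply: gxy => //.
move=> c'; rewrite in_cons => /predU1P[->|/us//] /andP[uc cv].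
by move/negP: cxy; apply; rewrite (le_lt_trans xu uc) (lt_le_trans cv vy).
Qed.

Lemma affine_pl g a b : affine_on a b g -> piecewise_linear a b g.
Proof.
move=> [m [k gE]]; exists [::] => x y ax xy yb _; exists m, k => z /andP[xz zy].
by apply: gE; rewrite (le_trans ax xz) (le_trans zy yb).
Qed.

Lemma pl_glue g x y z :
  piecewise_linear x y g -> piecewise_linear y z g -> piecewise_linear x z g.
Proof.
move=> [s gs] [s' gs']; exists (y :: s ++ s') => u v xu uv vz us.
have sub : forall c, c \in s \/ c \in s' -> ~ (u < c < v).
  by move=> c cs; apply: us; rewrite in_cons mem_cat; case: cs => ->; rewrite !orbT.
have [vy|yv] := leP v y.
  by apply: gs => // c cs; apply: sub; left.
have [yu|uy] := leP y u.
  by apply: gs' => // c cs; apply: sub; right.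
by exfalso; apply: (us y); rewrite ?mem_head// uy.
Qed.

Lemma eq_pl g h a b : (forall z, a <= z <= b -> g z = h z) ->
  piecewise_linear a b h -> piecewise_linear a b g.
Proof.
move=> gh [s hs]; exists s => x y ax xy yb xs.
have [m [k hE]] := hs x y ax xy yb xs; exists m, k => z /andP[xz zy].
by rewrite gh ?hE ?xz// (le_trans ax xz) (le_trans zy yb).
Qed.

Lemma plD g h a b : piecewise_linear a b g -> piecewise_linear a b h ->
  piecewise_linear a b (fun z => g z + h z).
Proof.
move=> [s gs] [s' hs]; exists (s ++ s') => x y ax xy yb xs.
have [|m [k gE]] := gs x y ax xy yb.
  by move=> c cs; apply: xs; rewrite mem_cat cs.
have [|m' [k' hE]] := hs x y ax xy yb.
  by move=> c cs; apply: xs; rewrite mem_cat cs orbT.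
by exists (m + m'), (k + k') => z xzy; rewrite gE// hE//; lra.
Qed.

Lemma plZ r g a b : piecewise_linear a b g ->
  piecewise_linear a b (fun z => r * g z).
Proof.
move=> [s gs]; exists s => x y ax xy yb xs.
have [|m [k gE]] := gs x y ax xy yb; first exact: xs.
by exists (r * m), (r * k) => z xzy; rewrite gE//; ring.
Qed.

Lemma pl_cst r a b : piecewise_linear a b (fun=> r).
Proof. by apply: affine_pl; exists 0, r => z _; rewrite mul0r add0r. Qed.

(** On an affine piece the only new break point is the root of [m * z + k]; between break points [g]
    keeps its sign, so the minimum is either [0] or [g] throughout. *)
Lemma pl_min0 g a b : a < b -> piecewise_linear a b g ->
  piecewise_linear a b (fun z => Num.min (g z) 0).
Proof.
move=> ab plg; pose h z := Num.min (g z) 0.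
apply: (pl_ind (P := fun x y => piecewise_linear x y h) ab plg); last first.
  by move=> x y z _ _ _ _; exact: pl_glue.
move=> x y _ _ _ [m [k gE]].
(* For [m = 0] the quotient is [0], a harmless extra break point, since a constant function cannot
   change sign. *)
exists [:: - k / m] => u v xu uv vy us.
have gE' z : u <= z <= v -> g z = m * z + k.
  move=> /andP[uz zv]; apply: gE.
  by rewrite (le_trans xu uz) (le_trans zv vy).
have noroot z z' : u <= z <= v -> u <= z' <= v -> g z < 0 -> 0 < g z' -> False.
  move=> uzv uzv'; rewrite !gE'// => gz gz'.
  have m0 : m != 0 by apply/eqP => m0; move: gz gz'; rewrite m0; lra.
  apply: (us (- k / m)); first by rewrite mem_head.
  have rE : m * (- k / m) + k = 0 by field.
  set r := - k / m in rE *.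
  by move: m0; rewrite neq_lt => /orP[]m0; apply/andP; split; nra.
have [gneg|/contrapT gpos] := EM (~ exists2 z, u <= z <= v & g z < 0).
  exists 0, 0 => z uzv; rewrite mul0r addr0 /h; apply/min_idPr.
  by rewrite leNgt; apply/negP => gz; apply: gneg; exists z.
have [z0 uz0 gz0] := gpos.
exists m, k => z uzv; rewrite -gE'// /h; apply/min_idPl.
by rewrite leNgt; apply/negP => gz; exact: (noroot z0 z).
Qed.

Lemma pl_min g h a b : a < b -> piecewise_linear a b g ->
  piecewise_linear a b h -> piecewise_linear a b (fun z => Num.min (g z) (h z)).
Proof.
move=> ab plg plh.
(* Reduction to a minimum with [0]: [min(g, h) = min(g - h, 0) + h]. *)
apply: (@eq_pl _ (fun z => Num.min (g z + -1 * h z) 0 + h z)).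
  by move=> z _; rewrite mulN1r addr_minl subrK add0r.
by apply: plD => //; apply: pl_min0 => //; apply: plD => //; exact: plZ.
Qed.

Lemma pl_bounded g a b : a < b -> piecewise_linear a b g ->
  exists M, forall z, a <= z <= b -> `|g z| <= M.
Proof.
move=> ab plg.
apply: (pl_ind (P := fun x y => exists M, forall z, x <= z <= y -> `|g z| <= M)
  ab plg).
  move=> x y _ xy _ [m [k gE]]; exists (`|m| * (`|x| + `|y|) + `|k|) => z xzy.
  rewrite gE// (le_trans (ler_normD _ _))// lerD2r normrM ler_wpM2l//.
  have := ler_norm y; have := ler_norm (- x); rewrite normrN.
  have := normr_ge0 x; have := normr_ge0 y; rewrite ler_norml => *.
  by apply/andP; split; lra.
move=> x y z _ _ _ _ [M HM] [M' HM']; exists (Num.max M M') => t /andP[xt tz].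
have [ty|yt] := leP t y.
  by rewrite le_max HM// xt.
by rewrite le_max HM' ?orbT// (ltW yt).
Qed.

(** * One-sided slopes *)

(* [s] is the direction: [1] towards larger arguments, [-1] towards smaller. *)
Definition has_slope s g x m :=
  exists2 r, 0 < r & forall t, 0 <= t < r -> g (x + s * t) = g x + m * t.

Lemma has_slope_lim s g x m : has_slope s g x m ->
  lim ((g (x + s * t) - g x) / t @[t --> 0^'+]) = m.
Proof.
move=> [r r0 gE]; apply: lim_near_cst => //; near=> t.
have t0 : 0 < t by near: t; exact: nbhs_right_gt.
rewrite gE; last by rewrite (ltW t0)/=; near: t; exact: nbhs_right_lt.
by rewrite addrC addKr mulfK ?gt_eqF.
Unshelve. all: by end_near. Qed.

Lemma has_slope_up g x m : has_slope 1 g x m -> slope_up g x = m.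
Proof.
by move=> /has_slope_lim <-; rewrite /slope_up; under eq_fun do rewrite -[X in x + X]mul1r.
Qed.

Lemma has_slope_down g x m : has_slope (-1) g x m -> slope_down g x = m.
Proof.
by move=> /has_slope_lim <-; rewrite /slope_down; under eq_fun do rewrite -[X in x + X]mulN1r.
Qed.

Lemma affine_has_slope_up g m k x y : x < y ->
  (forall z, x <= z <= y -> g z = m * z + k) ->
  forall z, x <= z < y -> has_slope 1 g z m.
Proof.
move=> xy gE z /andP[xz zy]; exists (y - z); first by rewrite subr_gt0.
by move=> t /andP[t0 tr]; rewrite !gE; [ring|lra..].
Qed.

Lemma affine_has_slope_down g m k x y : x < y ->
  (forall z, x <= z <= y -> g z = m * z + k) ->
  forall z, x < z <= y -> has_slope (-1) g z (- m).
Proof.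
move=> xy gE z /andP[xz zy]; exists (z - x); first by rewrite subr_gt0.
by move=> t /andP[t0 tr]; rewrite !gE; [ring|lra..].
Qed.

(** The limit in [slope_up] is attained exactly: the function is affine just to the right of [x].
    This replaces limits by identities of germs; since the limit is determined by any such germ, it
    is enough to find some slope on each piece. *)
Lemma pl_has_slope_up g a b x : piecewise_linear a b g -> a <= x < b ->
  has_slope 1 g x (slope_up g x).
Proof.
move=> plg /andP[ax xb].
suff [m gm] : exists m, has_slope 1 g x m by rewrite (has_slope_up gm).
have ab : a < b by exact: le_lt_trans xb.
move: x ax xb; apply: (pl_ind (P := fun x y => forall z, x <= z -> z < y ->
  exists m, has_slope 1 g z m) ab plg).
  move=> x y _ xy _ [m [k gE]] z xz zy; exists m.
  by apply: affine_has_slope_up xy gE _ _; rewrite xz.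
move=> x y z _ _ _ _ Pxy Pyz t xt tz.
(* The joint [y] goes to the right-hand piece, which alone sees the upward direction there. *)
by have [ty|yt] := ltP t y; [exact: Pxy|exact: Pyz].
Qed.

Lemma pl_has_slope_down g a b x : piecewise_linear a b g -> a < x <= b ->
  has_slope (-1) g x (slope_down g x).
Proof.
move=> plg /andP[ax xb].
suff [m gm] : exists m, has_slope (-1) g x m by rewrite (has_slope_down gm).
have ab : a < b by exact: lt_le_trans xb.
move: x ax xb; apply: (pl_ind (P := fun x y => forall z, x < z -> z <= y ->
  exists m, has_slope (-1) g z m) ab plg).
  move=> x y _ xy _ [m [k gE]] z xz zy; exists (- m).
  by apply: affine_has_slope_down xy gE _ _; rewrite xz.
move=> x y z _ _ _ _ Pxy Pyz t xt tz.
by have [ty|yt] := leP t y; [exact: Pxy|exact: Pyz].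
Qed.

Lemma has_slopeD s g h x m m' : has_slope s g x m -> has_slope s h x m' ->
  has_slope s (fun z => g z + h z) x (m + m').
Proof.
move=> [r r0 gE] [r' r0' hE]; exists (Num.min r r'); first by rewrite lt_min r0.
move=> t /andP[t0]; rewrite lt_min => /andP[tr tr'].
by rewrite gE ?hE ?t0//; ring.
Qed.

Lemma has_slopeZ s g c x m : has_slope s g x m ->
  has_slope s (fun z => c * g z) x (c * m).
Proof. by move=> [r r0 gE]; exists r => // t /gE ->; ring. Qed.

Lemma has_slope_le s g h x m m' : has_slope s g x m -> has_slope s h x m' ->
  g x = h x -> (forall z, g z <= h z) -> m <= m'.
Proof.
(* Half the smaller radius lies strictly inside both ranges where the germs are affine. *)
move=> [r r0 gE] [r' r0' hE] ghx gh; pose t := Num.min r r' / 2.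
have mr : 0 < Num.min r r' by rewrite lt_min r0.
have t0 : 0 < t by rewrite divr_gt0.
have /andP[tr tr'] : (t < r) && (t < r') by rewrite -lt_min /t; lra.
have := gh (x + s * t); rewrite gE ?hE ?(ltW t0)// ghx lerD2l.
by rewrite ler_pM2r.
Qed.

(** At a joint of two affine pieces the vanishing slope sum forces equal slopes, and the common
    value then forces equal intercepts. *)
Lemma pl_harmonic_affine g a b : a < b -> piecewise_linear a b g ->
  (forall z, a < z < b -> slope_up g z + slope_down g z = 0) -> affine_on a b g.
Proof.
move=> ab plg.
apply: (pl_ind (P := fun x y => (forall z, x < z < y ->
  slope_up g z + slope_down g z = 0) -> affine_on x y g) ab plg) => //.
move=> x y z _ xy yz _ Pxy Pyz harm.
have [t /andP[xt ty]|m [k gE]] := Pxy.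
  by apply: harm; rewrite xt (lt_trans ty).
have [t /andP[yt tz]|m' [k' gE']] := Pyz.
  by apply: harm; rewrite tz (lt_trans xy yt).
have := harm y; rewrite xy yz => /(_ isT).
rewrite (has_slope_up (affine_has_slope_up yz gE' _)) ?lexx ?yz//.
rewrite (has_slope_down (affine_has_slope_down xy gE _)) ?lexx ?xy// => mm'.
have : g y = g y by []; rewrite {1}gE ?lexx ?ltW// gE' ?lexx ?ltW// => kk'.
exists m, k => t /andP[xt tz]; have [ty|yt] := leP t y.
  by apply: gE; rewrite xt.
have mE : m' = m by lra.
by rewrite gE' ?(ltW yt)//; move: kk'; rewrite mE => /addrI ->.
Qed.

End PiecewiseLinear.

(** * Finitely supported sums *)

Section FiniteSums.
Context {V : zmodType} {I : choiceType}.
Implicit Types (A B : set I) (F : I -> V).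

(** A sum over a set takes the default value [0] when its support is infinite, so additivity needs
    both supports to be finite. *)
Lemma fsum_setU A B F :
  finite_set (A `&` [set i | F i != 0]) -> finite_set (B `&` [set i | F i != 0]) ->
  A `&` B = set0 ->
  \sum_(i \in A `|` B) F i = \sum_(i \in A) F i + \sum_(i \in B) F i.
Proof.
have E : [set i | F i != 0] = F @^-1` [set~ 0].
  by apply/seteqP; split=> i /eqP.
rewrite E => fA fB AB0.
rewrite fsbig_supp setIUl fsbigU//.
  by rewrite -!fsbig_supp.
by move=> i [[Ai _] [Bi _]]; have : (A `&` B) i by []; rewrite AB0.
Qed.

Lemma fsum_partition (K : finType) (c : I -> K) F :
  finite_set [set i | F i != 0] ->
  \sum_(i \in [set: I]) F i = \sum_k \sum_(i \in [set i | c i = k]) F i.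
Proof.
have E : [set i | F i != 0] = F @^-1` [set~ 0].
  by apply/seteqP; split=> i /eqP.
rewrite E => fF; rewrite fsbig_supp setTI fsbig_finite//.
rewrite (partition_big c predT)//=; apply: eq_bigr => k _.
rewrite fsbig_supp fsbig_finite; last by apply: sub_finite_set fF => i [].
rewrite -big_filter; apply: perm_big; apply: uniq_perm => //.
  by rewrite filter_uniq.
move=> i; rewrite mem_filter !in_fset_set//; last by apply: sub_finite_set fF => ? [].
by rewrite in_setI; congr (_ && _); apply/eqP/idP; rewrite inE.
Qed.

Lemma finite_suppD F H :
  finite_set [set i | F i != 0] -> finite_set [set i | H i != 0] ->
  finite_set [set i | F i + H i != 0].
Proof.
move=> fF fH; apply: (@sub_finite_set _ _ ([set i | F i != 0] `|` [set i | H i != 0])).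
  move=> i /=; have [->|] := eqVneq (F i) 0; last by left.
  by rewrite add0r; right.
by rewrite finite_setU.
Qed.

Lemma fsumD F H :
  finite_set [set i | F i != 0] -> finite_set [set i | H i != 0] ->
  \sum_(i \in [set: I]) (F i + H i) =
    \sum_(i \in [set: I]) F i + \sum_(i \in [set: I]) H i.
Proof.
move=> fF fH; pose S := [set i | F i != 0] `|` [set i | H i != 0].
have fS : finite_set S by rewrite finite_setU.
have SF i : ~ S i -> F i = 0 /\ H i = 0.
  by move=> /not_orP[/negP/negPn/eqP ? /negP/negPn/eqP].
rewrite -!(fsbig_widen S setT)//; first exact: fsbig_split.
- by move=> i [_ /SF[]].
- by move=> i [_ /SF[]].
- by move=> i [_ /SF[]] /= -> ->; rewrite addr0.
Qed.

End FiniteSums.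

(** * Slope changes inside an interval *)

Section Degree.
Context {R : realType}.
Implicit Types (g : R -> R) (a b : R).

(** An affine piece has no interior slope change, and its two end slopes [m] and [- m] cancel. When
    two pieces are glued at [y], their end slopes at [y] become exactly the interior term there. *)
Lemma pl_telescope g a b : a < b -> piecewise_linear a b g ->
  finite_set (`]a, b[ `&` [set z | slope_up g z + slope_down g z != 0]) /\
  \sum_(z \in `]a, b[) (slope_up g z + slope_down g z) =
    - (slope_up g a + slope_down g b).
Proof.
move=> ab plg; pose F z := slope_up g z + slope_down g z.
apply: (pl_ind (P := fun x y =>
  finite_set (`]x, y[ `&` [set z | F z != 0]) /\
  \sum_(z \in `]x, y[) F z = - (slope_up g x + slope_down g y)) ab plg).
  move=> x y _ xy _ [m [k gE]].
  have F0 z : x < z < y -> F z = 0.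
    move=> /andP[xz zy]; rewrite /F.
    rewrite (has_slope_up (affine_has_slope_up xy gE _)) ?zy ?ltW//.
    by rewrite (has_slope_down (affine_has_slope_down xy gE _)) ?xz ?ltW ?subrr.
  split.
    rewrite (_ : _ `&` _ = set0)//; apply/seteqP; split=> z //= [].
    by rewrite in_itv/= => /F0 ->; rewrite eqxx.
  rewrite fsbig1; last by move=> z /=; rewrite in_itv/=; exact: F0.
  rewrite (has_slope_up (affine_has_slope_up xy gE _)) ?lexx//.
  by rewrite (has_slope_down (affine_has_slope_down xy gE _)) ?lexx ?xy// subrr oppr0.
move=> x y z _ xy yz _ [fxy Sxy] [fyz Syz].
have E : `]x, z[%classic = `]x, y[ `|` ([set y] `|` `]y, z[).
  apply/seteqP; split=> t /=; rewrite !in_itv/=.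
    move=> /andP[xt tz]; have [ty|yt|->] := ltgtP t y.
    - by left; rewrite xt.
    - by right; right.
    - by right; left.
  case=> [/andP[xt ty]|[->|/andP[yt tz]]]; rewrite ?xy ?yz//.
    by rewrite xt (lt_trans ty).
  by rewrite tz (lt_trans xy).
have f1 : finite_set (([set y] `|` `]y, z[) `&` [set z | F z != 0]).
  rewrite setIUl finite_setU; split=> //.
  by apply: sub_finite_set (finite_set1 y) => t [].
split.
  by rewrite E setIUl finite_setU.
rewrite E fsum_setU//; last first.
  apply/seteqP; split=> t //= []; rewrite !in_itv/= => /andP[xt ty].
  by case=> [ty'|/andP[yt _]]; move: ty; [rewrite ty' ltxx|rewrite ltNge ltW].
rewrite fsum_setU//; last 2 first.
- by apply: sub_finite_set (finite_set1 y) => t [].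
- by apply/seteqP; split=> t //= [->]; rewrite in_itv/= ltxx.
by rewrite fsbig_set1 Sxy Syz /F; ring.
Qed.

End Degree.

(** * The Laplacian on a metric graph *)

Section Laplacian.
Context {R : realType} (G : metric_graph R).
Implicit Types (f g : gpoint G -> R) (p : gpoint G) (e : edge G) (v : vertex G).

Lemma edge_point0 e : edge_point e 0 = Vtx (src e).
Proof. by rewrite /edge_point insubF ?ltxx// lexx. Qed.

Lemma edge_point_len e : edge_point e (len e) = Vtx (tgt e).
Proof. by rewrite /edge_point insubF ?ltxx ?andbF// leNgt len_gt0. Qed.

Lemma edge_point_val e (u : {x : R | 0 < x < len e}) : edge_point e (val u) = Mid u.
Proof. by rewrite /edge_point valK. Qed.

Lemma gpoint_ind (P : gpoint G -> Prop) : (forall v, P (Vtx v)) ->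
  (forall e x, 0 < x < len e -> P (edge_point e x)) -> forall p, P p.
Proof.
move=> PV PE [v|e u]; first exact: PV.
by rewrite -edge_point_val; apply: PE; exact: (valP u).
Qed.

Lemma cont_plD f g : cont_pl f -> cont_pl g -> cont_pl (fun p => f p + g p).
Proof. by move=> plf plg e; apply: plD; [exact: plf|exact: plg]. Qed.

Lemma cont_plZ c f : cont_pl f -> cont_pl (fun p => c * f p).
Proof. by move=> plf e; apply: plZ; exact: plf. Qed.

Lemma cont_pl_cst (c : R) : cont_pl (fun _ : gpoint G => c).
Proof. by move=> e; exact: pl_cst. Qed.

Lemma cont_pl_min f g : cont_pl f -> cont_pl g ->
  cont_pl (fun p => Num.min (f p) (g p)).
Proof.
by move=> plf plg e; apply: pl_min; [exact: len_gt0|exact: plf|exact: plg].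
Qed.

Lemma cont_pl_sum (I : Type) (r : seq I) (F : I -> gpoint G -> R) :
  (forall i, cont_pl (F i)) -> cont_pl (fun p => \sum_(i <- r) F i p).
Proof.
move=> plF; elim: r => [|i r IH].
  by under eq_fun do rewrite big_nil; exact: cont_pl_cst.
by under eq_fun do rewrite big_cons; apply: cont_plD.
Qed.

Lemma cont_pl_bounded f : cont_pl f -> exists M, forall p, `|f p| <= M.
Proof.
move=> plf; have /choice[B fB] : forall e, exists M, forall z, 0 <= z <= len e ->
    `|f (edge_point e z)| <= M.
  by move=> e; apply: pl_bounded (len_gt0 e) (plf e).
(* The sum of finitely many nonnegative bounds dominates each of them. *)
exists (\sum_v `|f (Vtx v)| + \sum_e `|B e|); elim/gpoint_ind => [v|e x].
  rewrite (bigD1 v)//= -addrA lerDl addr_ge0//; apply: sumr_ge0 => //.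
move=> /andP[/ltW x0 /ltW xl]; apply: (le_trans (fB e x _)); first by rewrite x0.
apply: (le_trans (ler_norm _)); rewrite (bigD1 e)//= addrCA lerDl.
by rewrite addr_ge0// sumr_ge0.
Qed.

Lemma cont_pl_slope_up f e x : cont_pl f -> 0 <= x < len e ->
  has_slope 1 (f \o edge_point e) x (slope_up (f \o edge_point e) x).
Proof. by move=> plf; exact: pl_has_slope_up. Qed.

Lemma cont_pl_slope_down f e x : cont_pl f -> 0 < x <= len e ->
  has_slope (-1) (f \o edge_point e) x (slope_down (f \o edge_point e) x).
Proof. by move=> plf; exact: pl_has_slope_down. Qed.

Lemma len_itv0 e : 0 <= (0 : R) < len e.
Proof. by rewrite lexx len_gt0. Qed.

Lemma len_itv1 e : 0 < len e <= len e.
Proof. by rewrite lexx len_gt0. Qed.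

Hint Resolve len_itv0 len_itv1 : core.

Lemma mid_itv e (u : {x : R | 0 < x < len e}) :
  (0 <= val u < len e) /\ (0 < val u <= len e).
Proof. by case/andP: (valP u) => u0 u1; rewrite u0 u1 !ltW. Qed.

Lemma laplacian_linear f g c : cont_pl f -> cont_pl g ->
  laplacian (fun p => f p + c * g p) = fun p => laplacian f p + c * laplacian g p.
Proof.
move=> plf plg; apply/funext => p; rewrite /laplacian mulrN -opprD; congr (- _).
have up e x : 0 <= x < len e ->
    slope_up ((fun p => f p + c * g p) \o edge_point e) x =
    slope_up (f \o edge_point e) x + c * slope_up (g \o edge_point e) x.
  move=> xe; apply: has_slope_up; apply: has_slopeD.
    exact: cont_pl_slope_up.
  by apply: has_slopeZ; exact: cont_pl_slope_up.
have down e x : 0 < x <= len e ->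
    slope_down ((fun p => f p + c * g p) \o edge_point e) x =
    slope_down (f \o edge_point e) x + c * slope_down (g \o edge_point e) x.
  move=> xe; apply: has_slope_down; apply: has_slopeD.
    exact: cont_pl_slope_down.
  by apply: has_slopeZ; exact: cont_pl_slope_down.
case: p => [v|e u] /=.
  rewrite (eq_bigr _ (fun e _ => up e 0 (len_itv0 e))).
  rewrite (eq_bigr _ (fun e _ => down e (len e) (len_itv1 e))).
  by rewrite !big_split/= -!mulr_sumr; ring.
have [u0 u1] := mid_itv u; rewrite up// down//; ring.
Qed.

Lemma laplacian_cst (c : R) : laplacian (fun _ : gpoint G => c) = fun=> 0.
Proof.
have s0 s e x : has_slope s ((fun=> c) \o @edge_point R G e) x 0.
  by exists 1 => // t _ /=; rewrite mul0r addr0.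
apply/funext => -[v|e u]; rewrite /laplacian /=.
  rewrite !big1 ?addr0 ?oppr0// => e _; first exact: has_slope_down.
  exact: has_slope_up.
by rewrite (has_slope_up (s0 _ _ _)) (has_slope_down (s0 _ _ _)) addr0 oppr0.
Qed.

Lemma laplacianD f g : cont_pl f -> cont_pl g ->
  laplacian (fun p => f p + g p) = fun p => laplacian f p + laplacian g p.
Proof.
move=> plf plg; have := laplacian_linear 1 plf plg.
by under eq_fun do rewrite mul1r; under [in RHS]eq_fun do rewrite mul1r.
Qed.

Lemma laplacianZ c f : cont_pl f ->
  laplacian (fun p => c * f p) = fun p => c * laplacian f p.
Proof.
move=> plf; have := laplacian_linear c (cont_pl_cst 0) plf.
by under eq_fun do rewrite add0r; rewrite laplacian_cst; under [in RHS]eq_fun do rewrite add0r.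
Qed.

Lemma laplacianB f g : cont_pl f -> cont_pl g ->
  laplacian (fun p => f p - g p) = fun p => laplacian f p - laplacian g p.
Proof.
move=> plf plg; have := laplacian_linear (-1) plf plg.
by under eq_fun do rewrite mulN1r; under [in RHS]eq_fun do rewrite mulN1r.
Qed.

Lemma cont_plB f g : cont_pl f -> cont_pl g -> cont_pl (fun p => f p - g p).
Proof.
move=> plf plg; have := cont_plD plf (cont_plZ (-1) plg).
by under eq_fun do rewrite mulN1r.
Qed.

Lemma cont_plDc f c : cont_pl f -> cont_pl (fun p => f p + c).
Proof. by move=> plf; apply: cont_plD => //; exact: cont_pl_cst. Qed.

Lemma laplacianDc f c : cont_pl f -> laplacian (fun p => f p + c) = laplacian f.
Proof.
move=> plf; rewrite laplacianD ?laplacian_cst//; last exact: cont_pl_cst.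
by under eq_fun do rewrite addr0.
Qed.

Lemma laplacian_sum (I : Type) (r : seq I) (F : I -> gpoint G -> R) :
  (forall i, cont_pl (F i)) ->
  laplacian (fun p => \sum_(i <- r) F i p) = fun p => \sum_(i <- r) laplacian (F i) p.
Proof.
move=> plF; elim: r => [|i r IH].
  under eq_fun do rewrite big_nil; rewrite laplacian_cst.
  by apply/funext => p; rewrite big_nil.
under eq_fun do rewrite big_cons; rewrite laplacianD ?IH//; last exact: cont_pl_sum.
by apply/funext => p; rewrite big_cons.
Qed.

(** Where [f] touches [g] from below, each outgoing slope of [f] is at most that of [g]; the sign in
    the Laplacian reverses the inequality. *)
Lemma laplacian_le f g p : cont_pl f -> cont_pl g -> f p = g p ->
  (forall q, f q <= g q) -> laplacian g p <= laplacian f p.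
Proof.
move=> plf plg fgp fg; rewrite /laplacian lerN2.
have up e x : 0 <= x < len e -> f (edge_point e x) = g (edge_point e x) ->
    slope_up (f \o edge_point e) x <= slope_up (g \o edge_point e) x.
  move=> xe fgx; apply: has_slope_le (cont_pl_slope_up plf xe)
    (cont_pl_slope_up plg xe) fgx _ => z; exact: fg.
have down e x : 0 < x <= len e -> f (edge_point e x) = g (edge_point e x) ->
    slope_down (f \o edge_point e) x <= slope_down (g \o edge_point e) x.
  move=> xe fgx; apply: has_slope_le (cont_pl_slope_down plf xe)
    (cont_pl_slope_down plg xe) fgx _ => z; exact: fg.
case: p fgp => [v|e u] fgp /=.
  apply: lerD; apply: ler_sum => e /eqP ev.
    by apply: up => //; rewrite edge_point0 ev.
  by apply: down => //; rewrite edge_point_len ev.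
have [u0 u1] := mid_itv u; apply: lerD.
  by apply: up => //; rewrite edge_point_val.
by apply: down => //; rewrite edge_point_val.
Qed.

Lemma laplacian_edge_point f e x : 0 < x < len e ->
  laplacian f (edge_point e x) =
  - (slope_up (f \o edge_point e) x + slope_down (f \o edge_point e) x).
Proof. by move=> xe; rewrite {1}/edge_point insubT. Qed.

(** Labels a point by its cell, a vertex or an open edge, so that a sum over the graph splits into
    finitely many sums. *)
Definition gpoint_cell p : vertex G + edge G :=
  match p with Vtx v => inl v | Mid e _ => inr e end.

Lemma gpoint_cell_vtx v : [set p | gpoint_cell p = inl v] = [set Vtx v].
Proof. by apply/seteqP; split=> [[w|e u]|p] //= => [[->]|->]. Qed.

Lemma gpoint_cell_edge e :
  [set p | gpoint_cell p = inr e] = edge_point e @` `]0, len e[.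
Proof.
apply/seteqP; split=> p /=.
  case: p => [//|e' u] /= [e'e]; rewrite -{}e'e; exists (val u).
    by rewrite /= in_itv; exact: (valP u).
  exact: edge_point_val.
by move=> [x]; rewrite in_itv/= => xe <-; rewrite /edge_point insubT.
Qed.

Lemma edge_point_inj e : set_inj `]0, len e[ (edge_point e).
Proof.
move=> x y; rewrite !inE/= !in_itv/= => xe ye; rewrite /edge_point !insubT.
by move=> /(congr1 (fun p => if p is Mid _ u then val u else 0)).
Qed.

Lemma fsum_gpoint (F : gpoint G -> R) : finite_set [set p | F p != 0] ->
  \sum_(p \in [set: gpoint G]) F p =
  \sum_v F (Vtx v) + \sum_e \sum_(x \in `]0, len e[) F (edge_point e x).
Proof.
move=> fF; rewrite (fsum_partition gpoint_cell)// big_sumType/=; congr (_ + _).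
  by apply: eq_bigr => v _; rewrite gpoint_cell_vtx fsbig_set1.
apply: eq_bigr => e _; rewrite gpoint_cell_edge fsbig_image//.
exact: edge_point_inj.
Qed.

(** Besides the vertices, only points where the slope changes can contribute, and each edge has
    finitely many of these. *)
Lemma finite_supp_laplacian f : cont_pl f -> finite_set [set p | laplacian f p != 0].
Proof.
move=> plf; pose S e := `]0, len e[ `&` [set x |
  slope_up (f \o edge_point e) x + slope_down (f \o edge_point e) x != 0].
apply: (@sub_finite_set _ _ (range (@Vtx R G) `|`
    \bigcup_(e in [set: edge G]) edge_point e @` S e)).
  elim/gpoint_ind => [v _|e x xe]; first by left; exists v.
  rewrite /= laplacian_edge_point// oppr_eq0 => sx; right; exists e => //.
  by exists x => //; split; rewrite //= in_itv.
rewrite finite_setU; split; first exact/finite_image/finite_finset.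
apply: bigcup_finite; first exact: finite_finset.
by move=> e _; apply: finite_image; case: (pl_telescope (len_gt0 e) (plf e)).
Qed.

(** By telescoping, the interior of an edge contributes the sum of its two end slopes; the vertices
    contribute the same end slopes with the opposite sign. *)
Lemma laplacian_degree f : cont_pl f ->
  \sum_(p \in [set: gpoint G]) laplacian f p = 0.
Proof.
move=> plf; rewrite fsum_gpoint; last exact: finite_supp_laplacian.
have E e : \sum_(x \in `]0, len e[) laplacian f (edge_point e x) =
    slope_up (f \o edge_point e) 0 + slope_down (f \o edge_point e) (len e).
  rewrite -[RHS]opprK; have [fS <-] := pl_telescope (len_gt0 e) (plf e).
  rewrite -mulN1r mulr_fsumr; apply: eq_fsbigr => x; rewrite inE/= in_itv/= => xe.
  by rewrite laplacian_edge_point// mulN1r.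
rewrite (eq_bigr _ (fun e _ => E e)) sumrN !big_split/=.
rewrite [X in _ + X](_ : _ = \sum_v (\sum_(e | src e == v) slope_up (f \o edge_point e) 0)
   + \sum_v (\sum_(e | tgt e == v) slope_down (f \o edge_point e) (len e))).
  by rewrite addNr.
by congr (_ + _); apply: partition_big.
Qed.

(** The weighted discrete Laplacian with conductance [1 / len e]. A loop occurs in both sums, each
    time with the term [0]. *)
Definition graph_laplacian (phi : vertex G -> R) v : R :=
  \sum_(e | src e == v) (phi v - phi (tgt e)) / len e +
  \sum_(e | tgt e == v) (phi v - phi (src e)) / len e.

Lemma laplacian_affine f :
  (forall e, affine_on 0 (len e) (f \o edge_point e)) ->
  (forall v, laplacian f (Vtx v) = graph_laplacian (f \o @Vtx R G) v) /\
  (forall e u, laplacian f (@Mid R G e u) = 0).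
Proof.
move=> aff.
have E e : exists2 m, (forall x, 0 <= x < len e -> slope_up (f \o edge_point e) x = m)
    /\ (forall x, 0 < x <= len e -> slope_down (f \o edge_point e) x = - m)
  & m = (f (Vtx (tgt e)) - f (Vtx (src e))) / len e.
  have [m [k fE]] := aff e; exists m; first split => x xe.
  - by apply: has_slope_up; exact: (affine_has_slope_up (len_gt0 e) fE).
  - by apply: has_slope_down; exact: (affine_has_slope_down (len_gt0 e) fE).
  have := fE (len e); have := fE 0; rewrite /= edge_point0 edge_point_len.
  rewrite !lexx !ltW ?len_gt0// => -> // -> //; field.
  by rewrite gt_eqF ?len_gt0.
split=> [v|e u].
  rewrite /laplacian/= /graph_laplacian opprD -!sumrN; congr (_ + _).
    apply: eq_bigr => e /eqP ev; have [m [-> // _] ->] := E e.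
    by rewrite -mulNr opprB -ev.
  apply: eq_bigr => e /eqP ev; have [m [_ -> //] ->] := E e.
  by rewrite opprK -ev.
have [u0 u1] := mid_itv u; have [m [up down] _] := E e.
by rewrite /laplacian/= up// down// subrr oppr0.
Qed.

End Laplacian.

(** * Existence and uniqueness of potentials *)

Section Potential.
Context {R : realType} (G : metric_graph R).
Implicit Types (f g : gpoint G -> R) (p : gpoint G) (e : edge G) (v : vertex G).

(** Maximum principle: at a vertex of maximal value all summands are nonnegative, so a zero total
    makes every neighbour maximal too, and connectedness spreads this to all vertices. *)
Lemma graph_laplacian_ker (phi : vertex G -> R) :
  (forall v, graph_laplacian phi v = 0) -> forall v w, phi v = phi w.
Proof.
move=> harm.
have [v0 _ vmax] : exists2 v0, true & forall v, phi v <= phi v0.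
  have /card_gt0P[w _] := vertex_gt0 G.
  case: (@Order.TotalTheory.arg_maxP _ _ _ w predT phi isT) => v0 _ vmax.
  by exists v0 => // v; exact: vmax.
have nbr v : phi v = phi v0 ->
    (forall e, src e = v -> phi (tgt e) = phi v0) /\
    (forall e, tgt e = v -> phi (src e) = phi v0).
  move=> pv; have pos w e : 0 <= (phi v - phi w) / len e.
    by rewrite divr_ge0 ?subr_ge0 ?pv// ltW ?len_gt0.
  have := harm v; rewrite /graph_laplacian => /eqP; rewrite paddr_eq0 ?sumr_ge0//.
  rewrite !psumr_eq0// => /andP[/allP s0 /allP t0].
  split=> e ev.
    have := s0 e (mem_index_enum _); rewrite ev eqxx/= mulf_eq0 invr_eq0.
    by rewrite (gt_eqF (len_gt0 e)) orbF subr_eq0 pv => /eqP.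
  have := t0 e (mem_index_enum _); rewrite ev eqxx/= mulf_eq0 invr_eq0.
  by rewrite (gt_eqF (len_gt0 e)) orbF subr_eq0 pv => /eqP.
suff all_max v : phi v = phi v0 by move=> v w; rewrite !all_max.
pose rel := (fun x y : vertex G => [exists e, ((src e == x) && (tgt e == y)) ||
  ((src e == y) && (tgt e == x))]).
(* The maximal vertices form a set closed under adjacency. *)
have cl : fingraph.closed rel [pred v | phi v == phi v0].
  move=> x y /existsP[e /orP[]/andP[/eqP ex /eqP ey]]; rewrite !inE.
    by apply/eqP/eqP => [/nbr[H _]|/nbr[_ H]]; [rewrite -ey|rewrite -ex]; exact: H.
  by apply/eqP/eqP => [/nbr[_ H]|/nbr[H _]]; [rewrite -ex|rewrite -ey]; exact: H.
have := closed_connect cl (graph_connected v0 v); rewrite !inE eqxx.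
by move=> /esym/eqP.
Qed.

(** Such an [f] is affine on every edge, so its vertex values are harmonic for the discrete
    Laplacian, hence constant; an affine function with equal end values is constant. *)
Lemma laplacian_eq0_cst f : cont_pl f -> (forall p, laplacian f p = 0) ->
  forall p q, f p = f q.
Proof.
move=> plf harm.
have aff e : affine_on 0 (len e) (f \o edge_point e).
  apply: pl_harmonic_affine (len_gt0 e) (plf e) _ => z ze.
  by apply/eqP; rewrite -oppr_eq0 -laplacian_edge_point// harm.
have [lapV _] := laplacian_affine aff.
have vcst v w : f (Vtx v) = f (Vtx w).
  apply: (@graph_laplacian_ker (f \o @Vtx R G)) => {}v.
  by rewrite -lapV harm.
have ecst e x : 0 < x < len e -> f (edge_point e x) = f (Vtx (src e)).
  move=> /andP[/ltW x0 /ltW x1]; have [m [k fE]] := aff e.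
  have len0 := len_gt0 e.
  have /= E0 := fE 0; have /= E1 := fE (len e); have /= Ex := fE x.
  move: E0 E1 Ex; rewrite edge_point0 edge_point_len x0 x1 !lexx (ltW len0).
  move=> /(_ isT) E0 /(_ isT) E1 /(_ isT) ->.
  have : m * len e = 0 by have := vcst (tgt e) (src e); rewrite E1 E0; lra.
  by move/eqP; rewrite E0 mulf_eq0 (gt_eqF len0) orbF => /eqP ->; rewrite !mul0r.
have /card_gt0P[v0 _] := vertex_gt0 G.
suff all0 p : f p = f (Vtx v0) by move=> p q; rewrite !all0.
by elim/(@gpoint_ind R G): p => [v|e x xe]; rewrite ?ecst//; exact: vcst.
Qed.

Lemma eq_laplacian f g : cont_pl f -> cont_pl g -> laplacian f = laplacian g ->
  exists k, forall p, f p = g p + k.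
Proof.
move=> plf plg lfg; have /card_gt0P[v0 _] := vertex_gt0 G.
exists (f (Vtx v0) - g (Vtx v0)) => p.
have /= <- : f p - g p = f (Vtx v0) - g (Vtx v0).
  apply: (laplacian_eq0_cst (cont_plB plf plg)) => q.
  by rewrite laplacianB// lfg subrr.
by rewrite addrC subrK.
Qed.

Lemma graph_laplacian_sum (phi : vertex G -> R) : \sum_v graph_laplacian phi v = 0.
Proof.
rewrite big_split/=.
have -> : \sum_v \sum_(e | src e == v) (phi v - phi (tgt e)) / len e =
    \sum_e (phi (src e) - phi (tgt e)) / len e.
  rewrite [RHS](partition_big (@src R G) predT)//=; apply: eq_bigr => v _.
  by apply: eq_bigr => e /eqP ->.
have -> : \sum_v \sum_(e | tgt e == v) (phi v - phi (src e)) / len e =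
    \sum_e (phi (tgt e) - phi (src e)) / len e.
  rewrite [RHS](partition_big (@tgt R G) predT)//=; apply: eq_bigr => v _.
  by apply: eq_bigr => e /eqP ->.
by rewrite -big_split/= big1// => e _; ring.
Qed.

(* The kernel of the discrete Laplacian has dimension at most 1 and its image
   lies in the hyperplane of functions of sum 0. *)
Lemma graph_laplacian_surj (b : vertex G -> R) : \sum_v b v = 0 ->
  exists phi, forall v, graph_laplacian phi v = b v.
Proof.
move=> sb; pose U := {ffun vertex G -> R^o}.
pose L (phi : U) : U := [ffun v => graph_laplacian phi v].
pose S (phi : U) : R^o := \sum_v phi v.
have linL : linear L.
  move=> a phi psi; apply/ffunP => v; rewrite !ffunE /graph_laplacian.
  rewrite scalerDr !scaler_sumr addrACA -!big_split/=; congr (_ + _).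
    by apply: eq_bigr => e _; rewrite !ffunE /GRing.scale/=; ring.
  by apply: eq_bigr => e _; rewrite !ffunE /GRing.scale/=; ring.
have linS : linear S.
  move=> a phi psi; rewrite /S scaler_sumr -big_split/=.
  by apply: eq_bigr => v _; rewrite !ffunE.
pose LL := GRing.isLinear.Build _ _ _ _ L linL.
pose LS := GRing.isLinear.Build _ _ _ _ S linS.
pose Ll : {linear U -> U} := HB.pack L LL.
pose Sl : {linear U -> R^o} := HB.pack S LS.
have LE phi : linfun Ll phi = L phi by rewrite lfunE.
have SE phi : linfun Sl phi = S phi by rewrite lfunE.
have /card_gt0P[v0 _] := vertex_gt0 G.
pose one : U := [ffun=> 1].
have kerL : (\dim (lker (linfun Ll)) <= 1)%N.
  rewrite (leq_trans (dimvS (_ : _ <= <[one]>)%VS)) ?dim_vline ?leq_b1//.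
  apply/subvP => phi; rewrite memv_ker LE => /eqP Lphi.
  apply/vlineP; exists (phi v0); apply/ffunP => v; rewrite !ffunE.
  rewrite /GRing.scale/= mulr1; apply: graph_laplacian_ker => w.
  by move/ffunP/(_ w): Lphi; rewrite !ffunE.
have sub : (limg (linfun Ll) <= lker (linfun Sl))%VS.
  apply/subvP => _ /memv_imgP[phi _ ->]; rewrite memv_ker SE LE.
  apply/eqP; rewrite /S; under eq_bigr do rewrite ffunE.
  exact: graph_laplacian_sum.
(* The sum functional is nonzero on [one], whose sum is the number of vertices. *)
have kerS : (\dim (lker (linfun Sl)) < \dim {:U})%N.
  rewrite ltnNge; apply/negP => dS.
  have : (lker (linfun Sl) == {:U})%VS by rewrite eqEdim subvf.
  move=> /eqP kS; have : one \in lker (linfun Sl) by rewrite kS memvf.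
  rewrite memv_ker SE /S; under eq_bigr do rewrite ffunE.
  rewrite sumr_const pnatr_eq0 => /eqP c0.
  by have := vertex_gt0 G; rewrite -[#|_|]/#|[pred _ : vertex G | true]| c0.
(* Rank and nullity: [dim ker S < dim U <= 1 + dim im L], so the inclusion of the image of [L] in
   the kernel of [S] is an equality. *)
have img : limg (linfun Ll) = lker (linfun Sl).
  apply/eqP; rewrite eqEdim sub /=.
  have := limg_ker_dim (linfun Ll) {:U}; rewrite capfv => dimL.
  by rewrite -ltnS (leq_trans kerS)// -dimL -add1n leq_add2r.
have : [ffun v => b v] \in lker (linfun Sl).
  by rewrite memv_ker SE /S; under eq_bigr do rewrite ffunE; apply/eqP.
rewrite -img => /memv_imgP[phi _ bE]; exists phi => v.
by move/ffunP/(_ v): bE; rewrite LE !ffunE.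
Qed.

(** Edge functions enter only at interior points; agreement with [phi] at the ends is a separate
    condition wherever it matters. *)
Definition glue_edges (phi : vertex G -> R) (h : edge G -> R -> R) p : R :=
  match p with Vtx v => phi v | Mid e u => h e (val u) end.

Lemma glue_edgesE phi h e z : h e 0 = phi (src e) -> h e (len e) = phi (tgt e) ->
  0 <= z <= len e -> glue_edges phi h (edge_point e z) = h e z.
Proof.
move=> h0 h1 /andP[]; rewrite le_eqVlt => /predU1P[<- _|z0].
  by rewrite edge_point0.
rewrite le_eqVlt => /predU1P[->|z1]; first by rewrite edge_point_len.
have ze : 0 < z < len e by rewrite z0.
by rewrite /edge_point insubT.
Qed.

(** The Laplacian is prescribed only inside the edges; the values that the tent creates at vertices
    are left free, to be corrected by a discrete problem. Hence the zero function serves when [p] is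
    a vertex. *)
Lemma tent p : exists2 f, cont_pl f &
  forall e u, laplacian f (@Mid R G e u) = (Mid u == p)%:R.
Proof.
elim/(@gpoint_ind R G): p => [v|e0 x xe].
  exists (fun=> 0); first exact: cont_pl_cst.
  by move=> e u; rewrite laplacian_cst; case: eqP.
have /andP[x0 x1] := xe; pose l := len e0.
(* A tent of slopes [l - x] and [- x] with peak [x * (l - x)]; its Laplacian at the peak is [l],
   which explains the final factor [l^-1]. *)
pose h e z := if e == e0 then if z <= x then z * (l - x) else (l - z) * x else 0.
pose f := glue_edges (fun=> 0) h.
have fE e z : 0 <= z <= len e -> f (edge_point e z) = h e z.
  apply: glue_edgesE; rewrite /h; case: eqVneq => // ee.
    by rewrite (ltW x0) mul0r.
  by rewrite ee leNgt x1/= subrr mul0r.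
have aff e : e != e0 -> affine_on 0 (len e) (f \o edge_point e).
  by move=> /negPf ee0; exists 0, 0 => z ze; rewrite /= fE// /h ee0; ring.
have aff1 z : 0 <= z <= x -> (f \o edge_point e0) z = (l - x) * z + 0.
  move=> /andP[z0 zx]; rewrite /= fE ?z0 ?(le_trans zx (ltW x1))//.
  by rewrite /h eqxx zx; ring.
have aff2 z : x <= z <= l -> (f \o edge_point e0) z = - x * z + l * x.
  move=> /andP[xz zl]; rewrite /= fE ?zl ?(le_trans (ltW x0) xz)//.
  rewrite /h eqxx; case: leP => zx; last by ring.
  have -> : z = x by apply: le_anti; rewrite zx xz.
  by ring.
have plf : cont_pl f.
  move=> e; have [->|/aff] := eqVneq e e0; last exact: affine_pl.
  apply: (@pl_glue _ _ _ x); apply: affine_pl.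
    by exists (l - x), 0; exact: aff1.
  by exists (- x), (l * x); exact: aff2.
have l0 : 0 < l by exact: len_gt0.
have lapf e z : 0 < z < len e ->
    laplacian f (edge_point e z) = l * (edge_point e z == edge_point e0 x)%:R.
  move=> ze; rewrite laplacian_edge_point//; have [ee0|ee0] := eqVneq e e0; last first.
    have [m [k gE]] := aff _ ee0; have /andP[z0 z1] := ze.
    rewrite (has_slope_up (affine_has_slope_up (len_gt0 e) gE _)) ?z1 ?ltW//.
    rewrite (has_slope_down (affine_has_slope_down (len_gt0 e) gE _)) ?z0 ?ltW//.
    rewrite subrr oppr0 /edge_point !insubT; case: eqP => [[/eqP]|_]; rewrite ?mulr0//.
    by rewrite (negPf ee0).
  rewrite {}ee0 in ze *.
  have /andP[z0 z1] := ze; have [zx|xz|zx] := ltgtP z x.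
  - rewrite (has_slope_up (affine_has_slope_up x0 aff1 _)) ?zx ?ltW//.
    rewrite (has_slope_down (affine_has_slope_down x0 aff1 _)) ?z0 ?ltW//.
    rewrite subrr oppr0; case: eqP => [/edge_point_inj|_]; rewrite ?mulr0//.
    by rewrite !inE/= !in_itv/= => /(_ ze xe) zx'; move: zx; rewrite zx' ltxx.
  - rewrite (has_slope_up (affine_has_slope_up x1 aff2 _)) ?z1 ?ltW//.
    rewrite (has_slope_down (affine_has_slope_down x1 aff2 _)) ?xz ?ltW//.
    rewrite subrr oppr0; case: eqP => [/edge_point_inj|_]; rewrite ?mulr0//.
    by rewrite !inE/= !in_itv/= => /(_ ze xe) zx'; move: xz; rewrite zx' ltxx.
  - rewrite zx eqxx (has_slope_up (affine_has_slope_up x1 aff2 _)) ?x1 ?lexx//.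
    rewrite (has_slope_down (affine_has_slope_down x0 aff1 _)) ?x0 ?lexx//.
    by rewrite mulr1; ring.
exists (fun p => l^-1 * f p); first exact: cont_plZ.
move=> e u; rewrite laplacianZ// -edge_point_val lapf ?mulKf ?gt_eqF//.
exact: (valP u).
Qed.

(** Tents weighted by [E] realise its part inside the edges. The remainder lives on the vertices and
    still has degree [0], so the discrete problem is solvable, and its solution is interpolated
    linearly along the edges. *)
Lemma laplacian_surj (E : gpoint G -> R) : finite_set [set p | E p != 0] ->
  \sum_(p \in [set: gpoint G]) E p = 0 -> exists2 f, cont_pl f & laplacian f = E.
Proof.
move=> fE E0; have /choice[F /all_and2[plF lapF]] : forall p, exists f, cont_pl f /\
    forall e u, laplacian f (@Mid R G e u) = (Mid u == p)%:R.
  by move=> p; have [f] := tent p; exists f.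
have [s sE] := (finite_seqP _).1 fE; pose r := undup s.
have rE p : (p \in r) = (E p != 0).
  rewrite mem_undup; apply/idP/idP => [ps|]; first by have : [set` s] p by []; rewrite -sE.
  by move=> Ep; have : [set p | E p != 0] p by []; rewrite sE.
pose f1 p := \sum_(q <- r) E q * F q p.
have plf1 : cont_pl f1 by apply: cont_pl_sum => q; exact: cont_plZ.
have lap1 e u : laplacian f1 (@Mid R G e u) = E (Mid u).
  rewrite laplacian_sum; last by move=> q; exact: cont_plZ.
  under eq_bigr do rewrite laplacianZ// lapF.
  have [ur|ur] := boolP (Mid u \in r).
    rewrite (bigD1_seq (Mid u)) ?undup_uniq//= eqxx mulr1 big1 ?addr0// => q qu.
    by rewrite eq_sym (negPf qu) mulr0.
  move: (ur); rewrite rE => /negPn/eqP ->.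
  rewrite big_seq big1// => q qr; case: eqP => [uq|_]; rewrite ?mulr0//.
  by move: ur; rewrite uq qr.
pose E' p := E p + -1 * laplacian f1 p.
have E'M e u : E' (@Mid R G e u) = 0 by rewrite /E' lap1 mulN1r subrr.
have plNf1 := cont_plZ (-1) plf1.
have lapN := laplacianZ (-1) plf1.
have fN : finite_set [set p | -1 * laplacian f1 p != 0].
  by have := finite_supp_laplacian plNf1; rewrite lapN.
have E'0 : \sum_v E' (Vtx v) = 0.
  have : \sum_(p \in [set: gpoint G]) E' p = 0.
    by rewrite fsumD// E0 add0r; have := laplacian_degree plNf1; rewrite lapN.
  rewrite fsum_gpoint; last exact: finite_suppD.
  rewrite [X in _ + X]big1 ?addr0// => e _; apply: fsbig1 => x /=.
  by rewrite in_itv/= => xe; rewrite /edge_point insubT.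
have [phi phiE] := graph_laplacian_surj E'0.
pose h e z := (phi (tgt e) - phi (src e)) / len e * z + phi (src e).
pose f2 := glue_edges phi h.
have aff e : affine_on 0 (len e) (f2 \o edge_point e).
  exists ((phi (tgt e) - phi (src e)) / len e), (phi (src e)) => z ze.
  rewrite /f2 /= glue_edgesE//.
    by rewrite /h mulr0 add0r.
  by rewrite /h mulfVK ?gt_eqF ?len_gt0 ?subrK.
have plf2 : cont_pl f2 by move=> e; exact: affine_pl.
have [lapV lapM] := laplacian_affine aff.
exists (fun p => f1 p + f2 p); first exact: cont_plD.
rewrite laplacianD//; apply/funext => -[v|e u].
  by rewrite lapV phiE /E'; ring.
by rewrite lapM lap1 addr0.
Qed.

End Potential.

(** * Tropical segments *)

Section Segments.
Context {R : realType} (G : metric_graph R).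
Implicit Types (f g : gpoint G -> R) (p : gpoint G) (D : gpoint G -> R) (d : R).

(** [potential] is a choice with default [0], so its properties depend on a solution existing; one
    does because [D2 - D1] has finite support and degree [0]. *)
Lemma effdiv_potential d D1 D2 : effdiv d D1 -> effdiv d D2 ->
  cont_pl (potential D1 D2) /\ laplacian (potential D1 D2) = D2 \- D1.
Proof.
move=> [f1 _ s1] [f2 _ s2].
suff ex : exists f, [set f | cont_pl f /\ laplacian f = D2 \- D1] f.
  exact: (xgetPex _ ex).
have fN : finite_set [set p | -1 * D1 p != 0].
  by apply: sub_finite_set f1 => p /=; rewrite mulN1r oppr_eq0.
have [||f plf lapf] := @laplacian_surj _ G (fun p => D2 p + -1 * D1 p).
- exact: finite_suppD.
- by rewrite fsumD// s2 -mulr_fsumr s1 mulN1r subrr.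
by exists f; split=> //; rewrite lapf; apply/funext => p /=; rewrite mulN1r.
Qed.

Lemma effdivD_laplacian d D f : effdiv d D -> cont_pl f ->
  (forall p, 0 <= D p + laplacian f p) -> effdiv d (D \+ laplacian f).
Proof.
move=> [fD _ sD] plf pos; have fl := finite_supp_laplacian plf.
split=> //; first exact: finite_suppD.
by rewrite fsumD// sD laplacian_degree// addr0.
Qed.

(** At each point the minimum touches [f] or [g] from below, so its coefficient there is at least
    that of one of two effective divisors. *)
Lemma effdiv_min d D f g : effdiv d D -> cont_pl f -> cont_pl g ->
  effdiv d (D \+ laplacian f) -> effdiv d (D \+ laplacian g) ->
  effdiv d (D \+ laplacian (fun p => Num.min (f p) (g p))).
Proof.
move=> eD plf plg [_ fpos _] [_ gpos _].
have plm := cont_pl_min plf plg.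
apply: effdivD_laplacian => // p; have [fg|gf] := leP (f p) (g p).
  apply: le_trans (fpos p) _; rewrite lerD2l; apply: laplacian_le => // [|q].
    by apply/min_idPl.
  by rewrite ge_min lexx.
apply: le_trans (gpos p) _; rewrite lerD2l; apply: laplacian_le => // [|q].
  by apply/min_idPr; exact: ltW.
by rewrite ge_min lexx orbT.
Qed.

Lemma le_inf_range f p : cont_pl f -> inf (range f) <= f p.
Proof.
move=> /cont_pl_bounded[M fM]; apply: ge_inf; last by exists p.
by exists (- M) => _ [q _ <-]; have := fM q; rewrite ler_norml => /andP[].
Qed.

Lemma le_sup_range f p : cont_pl f -> f p <= sup (range f).
Proof.
move=> /cont_pl_bounded[M fM]; apply: ub_le_sup; last by exists p.
by exists M => _ [q _ <-]; have := fM q; rewrite ler_norml => /andP[].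
Qed.

Lemma range_neq0 f : range f !=set0.
Proof. by have /card_gt0P[v _] := vertex_gt0 G; exists (f (Vtx v)), (Vtx v). Qed.

Lemma sup_range_le f M : (forall p, f p <= M) -> sup (range f) <= M.
Proof. by move=> fM; apply: ge_sup (range_neq0 f) _ => _ [p _ <-]. Qed.

Lemma inf_range_ge f M : (forall p, M <= f p) -> M <= inf (range f).
Proof. by move=> fM; apply: lb_le_inf (range_neq0 f) _ => _ [p _ <-]. Qed.

(** Any threshold acts, up to an additive constant, like one inside the range of [f]: below the
    range it gives [t = 0], above it [t = 1], and in between [t] is the relative height. *)
Lemma truncation f c : cont_pl f ->
  let I := inf (range f) in let r := sup (range f) - I in
  exists2 t, 0 <= t <= 1 &
    exists k, forall p, Num.min c (f p) = Num.min (t * r) (f p - I) + k.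
Proof.
move=> plf I r; have If p : I <= f p by exact: le_inf_range.
have fS p : f p <= I + r by rewrite /r addrC subrK; exact: le_sup_range.
have r0 : 0 <= r.
  have /card_gt0P[v _] := vertex_gt0 G.
  by have := If (Vtx v); have := fS (Vtx v); lra.
have [cI|Ic] := leP c I.
  exists 0; rewrite ?lexx ?ler01//; exists c => p; rewrite mul0r.
  by rewrite (min_idPl _) ?(le_trans cI)// (min_idPl _) ?subr_ge0// add0r.
have [rc|cr] := leP (I + r) c.
  exists 1; rewrite ?lexx ?ler01//; exists I => p; rewrite mul1r.
  rewrite (min_idPr _) ?(le_trans (fS p))// (min_idPr _) ?subrK//.
  by rewrite lerBlDl.
have rpos : 0 < r by lra.
exists ((c - I) / r).
  by rewrite divr_ge0 ?ler_pdivrMr ?mul1r//; lra.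
by exists I => p; rewrite mulfVK ?gt_eqF// addr_minl !subrK.
Qed.

(* Relative to a base divisor, tropical segments are the tropical linear
   combinations of representing functions. *)
Lemma tsegmentP d D0 D1 D2 D : effdiv d D0 -> effdiv d D1 -> effdiv d D2 ->
  tsegment D1 D2 D <-> exists f1 f2, [/\ cont_pl f1 /\ cont_pl f2,
    D1 = D0 \+ laplacian f1, D2 = D0 \+ laplacian f2 &
    D = D0 \+ laplacian (fun p => Num.min (f1 p) (f2 p))].
Proof.
move=> e0 e1 e2; have [plF lapF] := effdiv_potential e1 e2.
pose F := potential D1 D2; rewrite -/F in plF lapF.
split=> [[t _ <-]|[f1 [f2 [[pl1 pl2] D1E D2E ->]]]].
  have [plf lapf] := effdiv_potential e0 e1; pose f := potential D0 D1.
  rewrite -/f in plf lapf.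
  have plF' := cont_plDc (- inf (range F)) plF.
  (* Adding a representative [f] of [D1] to both arguments of the minimum turns the threshold and
     the shifted potential into representatives of [D1] and [D2]. *)
  exists (fun p => f p + t * rho D1 D2), (fun p => f p + (F p - inf (range F))).
  split; first split.
  - exact: cont_plDc.
  - exact: cont_plD.
  - by rewrite laplacianDc// lapf; apply/funext => p /=; rewrite addrC subrK.
  - rewrite laplacianD// laplacianDc// lapf lapF; apply/funext => p /=; ring.
  - under [in RHS]eq_fun do rewrite -addr_minr.
    rewrite laplacianD//; last by apply: cont_pl_min => //; exact: cont_pl_cst.
    by rewrite lapf; apply/funext => p; rewrite /tsegment_path /= -/F; ring.
have [k kE] : exists k, forall p, f2 p - f1 p = F p + k.
  apply: eq_laplacian => //; first exact: cont_plB.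
  by rewrite laplacianB// lapF D1E D2E; apply/funext => p /=; ring.
(* Here [min(f1, f2) = f1 + min(0, F + k) = f1 + min(- k, F) + k], which is a truncation of [F] at
   [- k]. *)
have [t t01 [k' k'E]] := truncation (- k) plF.
exists t => //; rewrite /tsegment_path -/F /rho -/F.
set m := fun p => Num.min _ _.
have plm : cont_pl m.
  by apply: cont_pl_min; [exact: cont_pl_cst|exact: cont_plDc].
have -> : (fun p => Num.min (f1 p) (f2 p)) = fun p => f1 p + (m p + (k' + k)).
  apply/funext => p; rewrite [m p + _]addrA -[m p + k']k'E addr_minl addNr addr_minr addr0.
  by rewrite -kE addrC subrK.
rewrite laplacianD ?laplacianDc//; last exact: cont_plDc.
by rewrite D1E; apply/funext => p /=; rewrite addrA.
Qed.

Lemma tsegment_effdiv d D1 D2 : effdiv d D1 -> effdiv d D2 ->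
  tsegment D1 D2 `<=` effdiv d.
Proof.
move=> e1 e2 D /(tsegmentP _ e1 e1 e2)[f1 [f2 [[pl1 pl2] E1 E2 ->]]].
by apply: effdiv_min => //; [rewrite -E1|rewrite -E2].
Qed.

Lemma tsegment_ends d D1 D2 : effdiv d D1 -> effdiv d D2 ->
  tsegment D1 D2 D1 /\ tsegment D1 D2 D2.
Proof.
move=> e1 e2; have [plF lapF] := effdiv_potential e1 e2.
split; [exists 0|exists 1]; rewrite /= ?lexx ?ler01// /tsegment_path.
  under [X in laplacian X]eq_fun => p do
    rewrite mul0r (min_idPl _) ?subr_ge0 ?le_inf_range//.
  by rewrite laplacian_cst; apply/funext => p /=; rewrite addr0.
under [X in laplacian X]eq_fun => p do
  rewrite mul1r (min_idPr _) ?lerB ?le_sup_range//.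
by rewrite laplacianDc// lapF; apply/funext => p /=; rewrite addrC subrK.
Qed.

Lemma tconvex_min d (T : set (gpoint G -> R)) D0 f g : T `<=` effdiv d ->
  tconvex T -> effdiv d D0 -> cont_pl f -> cont_pl g ->
  T (D0 \+ laplacian f) -> T (D0 \+ laplacian g) ->
  T (D0 \+ laplacian (fun p => Num.min (f p) (g p))).
Proof.
move=> sT cT e0 plf plg Tf Tg; apply: (cT _ _ Tf Tg).
by apply/(tsegmentP _ e0 (sT _ Tf) (sT _ Tg)); exists f, g.
Qed.

Lemma tconvex_union d (T T' : set (gpoint G -> R)) :
  T `<=` effdiv d -> T' `<=` effdiv d -> tconvex T -> tconvex T' ->
  tconvex (\bigcup_(D in T) \bigcup_(D' in T') tsegment D D').
Proof.
move=> sT sT' cT cT' D E [A TA [A' TA' DA]] [B TB [B' TB' EB]] X DEX.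
have eA := sT _ TA; have eA' := sT' _ TA'; have eB := sT _ TB; have eB' := sT' _ TB'.
have eD := tsegment_effdiv eA eA' DA; have eE := tsegment_effdiv eB eB' EB.
(* All divisors are represented over the common base [A]. *)
have [a [a' [[pla pla'] aE aE' DE]]] := (tsegmentP D eA eA eA').1 DA.
have [b [b' [[plb plb'] bE bE' EE]]] := (tsegmentP E eA eB eB').1 EB.
have [f [g [[plf plg] fE gE ->]]] := (tsegmentP X eA eD eE).1 DEX.
have inj f1 f2 : A \+ laplacian f1 = A \+ laplacian f2 -> laplacian f1 = laplacian f2.
  by move=> E12; apply/funext => p; move/(congr1 (@^~ p)): E12 => /= /addrI.
(* Both functions represent [D], hence differ by a constant, which can be absorbed into [a] and
   [a']. *)
have [k kE] : exists k, forall p, f p = Num.min (a p) (a' p) + k.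
  by apply: eq_laplacian => //; [exact: cont_pl_min|apply: inj; rewrite -fE].
have [l lE] : exists l, forall p, g p = Num.min (b p) (b' p) + l.
  by apply: eq_laplacian => //; [exact: cont_pl_min|apply: inj; rewrite -gE].
pose c p := Num.min (a p + k) (b p + l).
pose c' p := Num.min (a' p + k) (b' p + l).
have plc : cont_pl c by apply: cont_pl_min; exact: cont_plDc.
have plc' : cont_pl c' by apply: cont_pl_min; exact: cont_plDc.
have Tc : T (A \+ laplacian c).
  by apply: (tconvex_min sT cT eA); rewrite ?laplacianDc -?aE -?bE//; exact: cont_plDc.
have Tc' : T' (A \+ laplacian c').
  by apply: (tconvex_min sT' cT' eA); rewrite ?laplacianDc -?aE' -?bE'//; exact: cont_plDc.
exists (A \+ laplacian c) => //; exists (A \+ laplacian c') => //.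
apply/(tsegmentP _ eA (sT _ Tc) (sT' _ Tc')); exists c, c'; split=> //.
congr (_ \+ laplacian _); apply/funext => p.
by rewrite kE lE /c /c' !addr_minl minACA.
Qed.

Lemma tconv_union d (T T' : set (gpoint G -> R)) :
  T `<=` effdiv d -> T' `<=` effdiv d -> tconvex T -> tconvex T' ->
  (T !=set0 <-> T' !=set0) ->
  tconv d (T `|` T') = \bigcup_(D in T) \bigcup_(D' in T') tsegment D D'.
Proof.
move=> sT sT' cT cT' ne; apply/seteqP; split.
  (* The union of segments is itself one of the convex sets being intersected. *)
  apply: bigcap_inf; split; last 2 first.
  - exact: (tconvex_union sT sT').
  - move=> D [TD|TD].
      have [D' TD'] : T' !=set0 by apply/ne; exists D.
      exists D => //; exists D' => //.
      by have [] := tsegment_ends (sT _ TD) (sT' _ TD').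
    have [D' TD'] : T !=set0 by apply/ne; exists D.
    exists D' => //; exists D => //.
    by have [] := tsegment_ends (sT _ TD') (sT' _ TD).
  by move=> X [D TD [D' TD']]; apply: tsegment_effdiv; [exact: sT|exact: sT'].
move=> X [D TD [D' TD' XD]] C [_ cC TC].
by apply: cC XD; apply: TC; [left|right].
Qed.

End Segments.

(** * The metric and compactness *)

Section Metric.
Context {R : realType} (G : metric_graph R).
Implicit Types (f g : gpoint G -> R) (p : gpoint G) (D E : gpoint G -> R) (d : R).

(** Together with [rho_le], this lets [rho] be computed as the oscillation of any solution [f], not
    only of the chosen potential. *)
Lemma rho_ge d D1 D2 f : effdiv d D1 -> effdiv d D2 -> cont_pl f ->
  laplacian f = D2 \- D1 -> forall p q, f p - f q <= rho D1 D2.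
Proof.
move=> e1 e2 plf lapf p q; have [plF lapF] := effdiv_potential e1 e2.
have [|k kE] := eq_laplacian plf plF; first by rewrite lapF.
rewrite !kE /rho; have := le_sup_range p plF; have := le_inf_range q plF; lra.
Qed.

Lemma rho_le d D1 D2 f M : effdiv d D1 -> effdiv d D2 -> cont_pl f ->
  laplacian f = D2 \- D1 -> (forall p q, f p - f q <= M) -> rho D1 D2 <= M.
Proof.
move=> e1 e2 plf lapf fM; have [plF lapF] := effdiv_potential e1 e2.
have [|k kE] := eq_laplacian plf plF; first by rewrite lapF.
rewrite /rho lerBlDr; apply: sup_range_le => p; rewrite -lerBlDl.
by apply: inf_range_ge => q; have := fM p q; rewrite !kE; lra.
Qed.

Lemma rho_xx d D : effdiv d D -> rho D D = 0.
Proof.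
move=> e; have l0 : laplacian (fun _ : gpoint G => 0) = D \- D.
  by rewrite laplacian_cst; apply/funext => p /=; rewrite subrr.
have /card_gt0P[v _] := vertex_gt0 G.
apply: le_anti; rewrite (rho_le e e (cont_pl_cst 0) l0) ?subrr//=.
by have := rho_ge e e (cont_pl_cst 0) l0 (Vtx v) (Vtx v); rewrite subrr.
Qed.

Lemma rho_triangle d D1 D2 D3 : effdiv d D1 -> effdiv d D2 -> effdiv d D3 ->
  rho D1 D3 <= rho D1 D2 + rho D2 D3.
Proof.
move=> e1 e2 e3; have [pl12 lap12] := effdiv_potential e1 e2.
have [pl23 lap23] := effdiv_potential e2 e3.
apply: (rho_le e1 e3 (cont_plD pl12 pl23)).
  by rewrite laplacianD// lap12 lap23; apply/funext => p /=; ring.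
move=> p q; have := rho_ge e1 e2 pl12 lap12 p q.
by have := rho_ge e2 e3 pl23 lap23 p q; lra.
Qed.

Lemma rho_sym d D1 D2 : effdiv d D1 -> effdiv d D2 -> rho D1 D2 = rho D2 D1.
Proof.
suff le (E1 E2 : gpoint G -> R) : effdiv d E1 -> effdiv d E2 -> rho E1 E2 <= rho E2 E1.
  by move=> e1 e2; apply: le_anti; rewrite !le.
move=> e1 e2; have [pl21 lap21] := effdiv_potential e2 e1.
apply: (rho_le e1 e2 (cont_plZ (-1) pl21)).
  by rewrite laplacianZ// lap21; apply/funext => p /=; ring.
by move=> p q; have := rho_ge e2 e1 pl21 lap21 q p; lra.
Qed.

Lemma rho_lipschitz d D1 D2 E1 E2 : effdiv d D1 -> effdiv d D2 ->
  effdiv d E1 -> effdiv d E2 ->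
  `|rho D1 D2 - rho E1 E2| <= rho D1 E1 + rho D2 E2.
Proof.
move=> d1 d2 e1 e2; rewrite ler_norml.
have := rho_triangle d1 e1 d2; have := rho_triangle e1 e2 d2.
have := rho_triangle e1 d1 e2; have := rho_triangle d1 d2 e2.
rewrite (rho_sym e2 d2) (rho_sym e1 d1); lra.
Qed.

(** A segment point indexed by its threshold [c] instead of the fraction [t]; any real [c] is
    allowed, so the thresholds for different pairs of ends can be compared directly. *)
Definition truncated D1 D2 c : gpoint G -> R :=
  D1 \+ laplacian (fun p => Num.min c
    (potential D1 D2 p - inf (range (potential D1 D2)))).

Lemma truncated_effdiv d D1 D2 c : effdiv d D1 -> effdiv d D2 ->
  effdiv d (truncated D1 D2 c).
Proof.
move=> e1 e2; have [plF lapF] := effdiv_potential e1 e2.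
apply: (@effdiv_min _ _ _ _ (fun=> c)) => //.
- exact: cont_pl_cst.
- exact: cont_plDc.
- rewrite laplacian_cst (_ : _ \+ _ = D1)//.
  by apply/funext => p /=; rewrite addr0.
- rewrite laplacianDc// lapF (_ : _ \+ _ = D2)//.
  by apply/funext => p /=; rewrite addrC subrK.
Qed.

(** The two truncated functions differ everywhere by at most [rho D1 E1 + rho D2 E2 + |c - c'|]. A
    potential between the two divisors is [a] plus this difference, so its oscillation is at most
    [rho D1 E1] plus twice that bound. *)
Lemma truncated_lipschitz d D1 D2 E1 E2 c c' : effdiv d D1 -> effdiv d D2 ->
  effdiv d E1 -> effdiv d E2 ->
  rho (truncated D1 D2 c) (truncated E1 E2 c') <=
    3 * (rho D1 E1 + rho D2 E2) + 2 * `|c - c'|.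
Proof.
move=> d1 d2 e1 e2.
have [plF lapF] := effdiv_potential d1 d2.
have [plF' lapF'] := effdiv_potential e1 e2.
have [pla lapa] := effdiv_potential d1 e1.
have [plb lapb] := effdiv_potential d2 e2.
have osca := rho_ge d1 e1 pla lapa; have oscb := rho_ge d2 e2 plb lapb.
rewrite /truncated; set F := potential D1 D2 in plF lapF *.
set F' := potential E1 E2 in plF' lapF' *.
set a := potential D1 E1 in pla lapa osca.
set b := potential D2 E2 in plb lapb oscb.
have [k kE] : exists k, forall p, F' p = F p + (b p - a p) + k.
  apply: eq_laplacian => //; first exact/cont_plD/cont_plB.
  rewrite laplacianD ?laplacianB//; last exact: cont_plB.
  by rewrite lapF' lapF lapa lapb; apply/funext => p /=; ring.
have inf_osc (h : gpoint G -> R) r : (forall p q, h p - h q <= r) ->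
    forall p, h p - r <= inf (range h).
  by move=> hr p; apply: inf_range_ge => q; have := hr p q; lra.
have a0 p : inf (range a) <= a p by exact: le_inf_range.
have b0 p : inf (range b) <= b p by exact: le_inf_range.
have a1 := inf_osc _ _ osca; have b1 := inf_osc _ _ oscb.
(* The error left when [F], [F'], [a] and [b] are all normalised to have infimum [0]; it lies
   between [- rho D2 E2] and [rho D1 E1]. *)
pose j := k + inf (range b) - inf (range a) - inf (range F') + inf (range F).
have j_ge : - rho D2 E2 <= j.
  suff : inf (range F') - k - inf (range b) - rho D2 E2 + inf (range a) <= inf (range F).
    by rewrite /j; lra.
  apply: inf_range_ge => p; have := le_inf_range p plF'; rewrite kE.
  by have := a0 p; have := b1 p; lra.
have j_le : j <= rho D1 E1.
  suff : inf (range F) + k + inf (range b) - rho D1 E1 - inf (range a) <= inf (range F').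
    by rewrite /j; lra.
  apply: inf_range_ge => p; have := le_inf_range p plF; rewrite kE.
  by have := b0 p; have := a1 p; lra.
pose m p := Num.min c (F p - inf (range F)).
pose m' p := Num.min c' (F' p - inf (range F')).
have plm : cont_pl m by apply: cont_pl_min; [exact: cont_pl_cst|exact: cont_plDc].
have plm' : cont_pl m' by apply: cont_pl_min; [exact: cont_pl_cst|exact: cont_plDc].
have mm' p : `|m' p - m p| <= rho D1 E1 + rho D2 E2 + `|c - c'|.
  rewrite /m /m'; have -> : F' p - inf (range F') = F p - inf (range F) +
      (b p - inf (range b)) - (a p - inf (range a)) + j by rewrite kE /j; ring.
  set x := F p - _; have := a0 p; have := a1 p; have := b0 p; have := b1 p.
  have := ler_norm (c - c'); have := ler_norm (- (c - c')); rewrite normrN.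
  rewrite ler_norml => *; apply/andP; split.
    by rewrite lerBrDl le_min !lerBlDr !ge_min;
      apply/andP; split; apply/orP; [left|right]; lra.
  by rewrite lerBlDr -lerBlDl le_min !lerBlDl !ge_min;
      apply/andP; split; apply/orP; [left|right]; lra.
apply: (@rho_le d _ _ (fun p => a p + (m' p - m p))).
- exact: truncated_effdiv.
- exact: truncated_effdiv.
- exact/cont_plD/cont_plB.
- rewrite laplacianD ?laplacianB//; last exact: cont_plB.
  by rewrite lapa; apply/funext => p /=; ring.
move=> p q; have := mm' p; have := mm' q; rewrite !ler_norml => /andP[? ?] /andP[? ?].
have := osca p q; have := a0 p; have := a1 p; have := b0 p; have := b1 p; lra.
Qed.

(** * The topology of the metric and continuity of truncation *)

Lemma effdiv_val_inj d : injective (@effdiv_val R G d).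
Proof.
by move=> [D e] [D' e'] /= DD'; move: e'; rewrite -DD' => e'; rewrite (Prop_irrelevance e e').
Qed.

Local Notation val := (@effdiv_val R G _).
Local Notation valP := (@effdiv_valP R G _).

(** The topology is given by its open sets; balls are open by the triangle inequality, so they form
    neighbourhood bases. *)
Lemma nbhs_rhoP d (D : effdiv_type G d) (A : set (effdiv_type G d)) :
  nbhs D A <-> exists2 r : R, 0 < r &
    forall D' : effdiv_type G d, rho (val D) (val D') < r -> A D'.
Proof.
rewrite nbhsE; split=> [[B [oB BD] BA]|[r r0 rA]].
  by have [r r0 rB] := oB D BD; exists r => // D' /rB /BA.
exists [set D' : effdiv_type G d | rho (val D) (val D') < r] => //; split; last first.
  by rewrite /= (rho_xx (valP D)).
move=> D' /= D'r; exists (r - rho (val D) (val D')); first by rewrite subr_gt0.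
move=> D'' D''r; have := rho_triangle (valP D) (valP D') (valP D''); lra.
Qed.

Section Filter.
Context {T : Type} {F : set_system T} {FF : Filter F} {d : R}.

Lemma cvg_rho (u : T -> effdiv_type G d) (D : effdiv_type G d) :
  u @ F --> D -> rho (val D) (val (u t)) @[t --> F] --> 0.
Proof.
move=> uD; apply/cvgr0Pnorm_lt => eps eps0.
apply: (uD [set D' : effdiv_type G d | `|rho (val D) (val D')| < eps]).
apply/nbhs_rhoP; exists eps => // D' DD'; rewrite /= ger0_norm//.
(* Nonnegativity: [0 = rho D D <= 2 * rho D D']. *)
have := rho_triangle (valP D) (valP D') (valP D); rewrite (rho_xx (valP D)).
by rewrite [X in _ + X](rho_sym (valP D') (valP D)); lra.
Qed.

Lemma rho_cvg (u : T -> effdiv_type G d) (D : effdiv_type G d) (b : T -> R) :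
  (forall t, rho (val D) (val (u t)) <= b t) -> b t @[t --> F] --> 0 -> u @ F --> D.
Proof.
move=> ub b0 A /nbhs_rhoP[r r0 rA]; change (F (u @^-1` A)); near=> t; apply: rA.
by apply: le_lt_trans (ub t) _; near: t; exact: cvgr_lt b0 _ r0.
Unshelve. all: by end_near. Qed.

Lemma cvg_rho2 (u v : T -> effdiv_type G d) (D E : effdiv_type G d) :
  u @ F --> D -> v @ F --> E ->
  rho (val (u t)) (val (v t)) @[t --> F] --> rho (val D) (val E).
Proof.
move=> uD vE; apply/cvgrPdist_lt => eps eps0.
near=> t; apply: le_lt_trans (rho_lipschitz (valP _) (valP _) (valP _) (valP _)) _.
near: t; apply: (cvgr_lt 0) eps0.
by rewrite -[X in _ --> X]addr0; apply: cvgD; exact: cvg_rho.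
Unshelve. all: by end_near. Qed.

Lemma cvg_truncated (u v : T -> effdiv_type G d) (D E : effdiv_type G d)
    (s : T -> R) (c : R) :
  u @ F --> D -> v @ F --> E -> s @ F --> c ->
  (fun t => EffDiv (truncated_effdiv (s t) (valP (u t)) (valP (v t)))) @ F -->
  EffDiv (truncated_effdiv c (valP D) (valP E)).
Proof.
move=> uD vE sc; pose b t := 3 * (rho (val D) (val (u t)) + rho (val E) (val (v t)))
  + 2 * `|c - s t|.
apply: (@rho_cvg _ _ b) => [t|].
  exact: truncated_lipschitz (valP _) (valP _) (valP _) (valP _).
have -> : 0 = 3 * (0 + 0) + 2 * `|c - c| :> R by rewrite subrr normr0; ring.
apply: cvgD; apply: cvgM; [exact: cvg_cst| |exact: cvg_cst|].
  by apply: cvgD; exact: cvg_rho.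
by apply: cvg_norm; apply: cvgB => //; exact: cvg_cst.
Qed.

End Filter.

Lemma tsegment_union_compact d (T T' : set (gpoint G -> R)) :
  T `<=` effdiv d -> T' `<=` effdiv d -> rho_compact d T -> rho_compact d T' ->
  rho_compact d (\bigcup_(D in T) \bigcup_(D' in T') tsegment D D').
Proof.
move=> sT sT' cT cT'.
pose X := (effdiv_type G d * effdiv_type G d * R)%type.
(* With threshold [t * rho] this is the segment path, extended to every real [t], so continuity can
   be shown on the whole product before restricting to [[0, 1]]. *)
pose Phi (x : X) := EffDiv (truncated_effdiv (x.2 * rho (val x.1.1) (val x.1.2))
  (valP x.1.1) (valP x.1.2)).
have PhiC : continuous Phi.
  move=> x.
  have c1 : x.1 @[x --> x] --> x.1 by exact: cvg_fst.
  have c11 : x.1.1 @[x --> x] --> x.1.1 by apply: cvg_comp c1 _; exact: cvg_fst.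
  have c12 : x.1.2 @[x --> x] --> x.1.2 by apply: cvg_comp c1 _; exact: cvg_snd.
  apply: cvg_truncated => //; apply: cvgM; first exact: cvg_snd.
  exact: cvg_rho2.
rewrite /rho_compact (_ : _ @^-1` _ = Phi @` ((val @^-1` T `*` (val @^-1` T')) `*` `[0, 1])).
  apply: continuous_compact; first exact: continuous_subspaceT.
  by apply: compact_setX; [exact: compact_setX|exact: segment_compact].
apply/seteqP; split=> D /=.
  move=> [D1 TD1 [D2 TD2 [t t01 DE]]].
  exists (EffDiv (sT _ TD1), EffDiv (sT' _ TD2), t); last exact: effdiv_val_inj.
  by split=> //=; rewrite in_itv.
move=> [[[D1 D2] t] [/= [TD1 TD2]]]; rewrite in_itv/= => t01 <- /=.
by exists (val D1) => //; exists (val D2) => //; exists t.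
Qed.

End Metric.

Lemma tconv_id (R : realType) (G : metric_graph R) (d : R)
  (T : set (gpoint G -> R)) : T `<=` effdiv d -> tconvex T -> tconv d T = T.
Proof.
move=> sT cT; apply/seteqP; split=> D; first by move=> /(_ T); apply; split.
by move=> TD C [_ _]; exact.
Qed.

(* The union formula fails when exactly one of T, T' is empty, hence its
   hypothesis. *)
Theorem theorem4p5 (R : realType) (G : metric_graph R) (d : R) (hd : 0 <= d)
  (T T' : set (gpoint G -> R))
  (sT : T `<=` effdiv d) (sT' : T' `<=` effdiv d)
  (cT : tconvex T) (cT' : tconvex T') :
  ((T !=set0 <-> T' !=set0) ->
    tconv d (T `|` T') =
      \bigcup_(D in T) \bigcup_(D' in T') tsegment D D') /\
  (rho_compact d T -> rho_compact d T' ->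
    rho_compact d (tconv d (T `|` T'))).
Proof.
split=> [|kT kT']; first exact: tconv_union.
(* If one set is empty, the hull is the other set, compact by hypothesis; the union formula is kept
   for two nonempty sets. *)
have [T0|/set0P Tne] := eqVneq T set0; first by rewrite T0 set0U tconv_id.
have [T0|/set0P T'ne] := eqVneq T' set0; first by rewrite T0 setU0 tconv_id.
by rewrite tconv_union//; exact: tsegment_union_compact.
Qed.
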